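(* Let $L/K$ be a quadratic field extension with $K$ of characteristic $\ne2$, which is Galois, and let $\tau\in\operatorname{Gal}(L/K)$ be the non-trivial element. Let $W_K$ be a $K$-vector space and equip $W_L=L\otimes_KW_K$ with the canonical semi-linear $\tau$-action. Let $W_+,W_-\subseteq W_L$ be two $L$-subspaces, and let $\varphi_+\colon W_+\to W_-^\tau$ and $\varphi_-\colon W_-\to W_+^\tau$ be $L$-linear isomorphisms such that \[ \varphi_-^\tau\circ\varphi_+=\mathbf 1_{W_+}+n \] with $n$ nilpotent of exponent $e\ge1$, i.e. $n^{e-1}\ne0$ and $n^e=0$. Then \[ \widetilde\varphi_\pm:=\tfrac12\bigl(\varphi_\pm+(\varphi_\mp^\tau)^{-1}\bigr) \] are $L$-linear isomorphisms $\widetilde\varphi_\pm\colon W_\pm\to W_\mp^\tau$ with \[ \widetilde\varphi_-^\tau\circ\widetilde\varphi_+=\mathbf 1_{W_+}+\widetilde n, \] where $\widetilde n$ is nilpotent of exponent $\widetilde e\le\lceil e/2\rceil$. Addendum: Suppose moreover $W_\pm=W_\mp^\tau$. Then the relations $\varphi_\pm\circ\varphi_\mp^\tau=\varphi_\mp^\tau\circ\varphi_\pm$ imply $\widetilde\varphi_\pm\circ\widetilde\varphi_\mp^\tau=\widetilde\varphi_\mp^\tau\circ\widetilde\varphi_\pm$. If, in addition to these relations for $\varphi_\pm$, one has $\varphi_\pm=\mathbf 1_{W_\pm}+m_\pm$ with $m_\pm$ nilpotent, then $\widetilde\varphi_\pm=\mathbf 1_{W_\pm}+\widetilde m_\pm$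 with $\widetilde m_\pm$ nilpotent.
   Context: The canonical semi-linear action is $\tau(a\otimes w)=\tau(a)\otimes w$. For an $L$-subspace $U\subseteq W_L$, $U^\tau=\tau(U)$. For an $L$-linear map $\phi\colon U\to U'$ between subspaces of $W_L$, $\phi^\tau=\tau\circ\phi\circ\tau^{-1}\colon U^\tau\to U'^\tau$, again $L$-linear. *)

(* Defs.v *)
From HB Require Import structures.
From mathcomp Require Import all_boot all_order all_fingroup all_algebra all_solvable all_field.
From mathcomp Require Import generic_quotient boolp classical_sets functions.

Set Implicit Arguments.
Unset Strict Implicit.
Unset Printing Implicit Defensive.

Import GRing.Theory.
Local Open Scope ring_scope.
Local Open Scope quotient_scope.

Section Tensor.
Variables (K : fieldType) (L : fieldExtType K) (W : lmodType K).

(* A list [:: (a1, w1); ...; (ar, wr)] stands for the formal sum of the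
   a_i (x) w_i; tensor_eq is the congruence on the monoid of formal sums
   generated by commutativity and K-bilinearity. *)
Inductive tensor_eq : seq (L * W) -> seq (L * W) -> Prop :=
| TensorRefl s : tensor_eq s s
| TensorSym s t : tensor_eq s t -> tensor_eq t s
| TensorTrans s t u : tensor_eq s t -> tensor_eq t u -> tensor_eq s u
| TensorCat s s' t t' :
    tensor_eq s s' -> tensor_eq t t' -> tensor_eq (s ++ t) (s' ++ t')
| TensorCatC s t : tensor_eq (s ++ t) (t ++ s)
| TensorZero w : tensor_eq [:: (0, w)] [::]
| TensorAddl a b w : tensor_eq [:: (a + b, w)] [:: (a, w); (b, w)]
| TensorAddr a v w : tensor_eq [:: (a, v + w)] [:: (a, v); (a, w)]
| TensorScale (c : K) a w : tensor_eq [:: (c *: a, w)] [:: (a, c *: w)].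

Definition tensor_rel : rel (seq (L * W)) := fun s t => `[< tensor_eq s t >].

Lemma tensor_rel_equiv : equiv_class_of tensor_rel.
Proof.
split=> [s|s t|t s u].
- exact/asboolP/TensorRefl.
- by apply/asboolP/asboolP; exact: TensorSym.
- by move=> /asboolP st /asboolP tu; apply/asboolP/(TensorTrans st tu).
Qed.

Canonical tensor_equiv := EquivRelPack tensor_rel_equiv.

Definition tensor : Type := {eq_quot tensor_equiv}.
HB.instance Definition _ := Choice.on tensor.
HB.instance Definition _ := EqQuotient.on tensor.

Definition formal_sum (s : seq (L * W)) : tensor := (\pi_tensor s).

Lemma tensorP s t : tensor_eq s t <-> formal_sum s = formal_sum t.
Proof. by split=> [?|/eqquotP/asboolP//]; apply/eqquotP/asboolP. Qed.

Lemma tensorW (P : tensor -> Prop) : (forall s, P (formal_sum s)) -> forall x, P x.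
Proof. by move=> Ps; elim/quotW=> s; exact: Ps. Qed.

Lemma tensor_reprK s : tensor_eq (repr (formal_sum s)) s.
Proof. by apply/tensorP; rewrite /formal_sum reprK. Qed.

Definition tensor_add (x y : tensor) : tensor := formal_sum (repr x ++ repr y).

Lemma tensor_addE s t :
  tensor_add (formal_sum s) (formal_sum t) = formal_sum (s ++ t).
Proof. by apply/tensorP/TensorCat; exact: tensor_reprK. Qed.

(* g (x) id, for g : L -> L *)
Definition tensor_map (g : L -> L) (x : tensor) : tensor :=
  formal_sum [seq (g p.1, p.2) | p <- repr x].

Lemma tensor_mapE (g : L -> L) : (forall c a b, g (c *: a + b) = c *: g a + g b) ->
  forall s, tensor_map g (formal_sum s) = formal_sum [seq (g p.1, p.2) | p <- s].
Proof.
move=> gP.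
have g0 : g 0 = 0.
  by have /eqP := gP 1 0 0; rewrite !scale1r addr0 -subr_eq0 opprD addrA subrr sub0r oppr_eq0 => /eqP.
have gD a b : g (a + b) = g a + g b by rewrite -[a in LHS]scale1r gP scale1r.
have gZ c a : g (c *: a) = c *: g a by rewrite -[c *: a]addr0 gP g0 addr0.
have gE s t : tensor_eq s t ->
    tensor_eq [seq (g p.1, p.2) | p <- s] [seq (g p.1, p.2) | p <- t].
  elim=> {s t} [s|s t _|s t u _ st _ tu|s s' t t' _ h _ k|s t|w|a b w|a v w|c a w] /=.
  - exact: TensorRefl.
  - exact: TensorSym.
  - exact: TensorTrans st tu.
  - by rewrite !map_cat; exact: TensorCat.
  - by rewrite !map_cat; exact: TensorCatC.
  - by rewrite g0; exact: TensorZero.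
  - by rewrite gD; exact: TensorAddl.
  - exact: TensorAddr.
  - by rewrite gZ; exact: TensorScale.
by move=> s; apply/tensorP/gE/tensor_reprK.
Qed.

Let tensor_zero : tensor := formal_sum [::].
Let tensor_opp : tensor -> tensor := tensor_map -%R.
Let tensor_scale (a : L) : tensor -> tensor := tensor_map ( *%R a).

Let tensor_oppE s : tensor_opp (formal_sum s) = formal_sum [seq (- p.1, p.2) | p <- s].
Proof. by apply: tensor_mapE => c a b; rewrite opprD scalerN. Qed.

Let tensor_scaleE a s :
  tensor_scale a (formal_sum s) = formal_sum [seq (a * p.1, p.2) | p <- s].
Proof. by apply: tensor_mapE => c b d; rewrite mulrDr scalerAr. Qed.

Let tensor_addA : associative tensor_add.
Proof. by elim/tensorW=> s; elim/tensorW=> t; elim/tensorW=> u; rewrite !tensor_addE catA. Qed.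

Let tensor_addC : commutative tensor_add.
Proof.
elim/tensorW=> s; elim/tensorW=> t; rewrite !tensor_addE; apply/tensorP; exact: TensorCatC.
Qed.

Let tensor_add0 : left_id tensor_zero tensor_add.
Proof. by elim/tensorW=> s; rewrite tensor_addE. Qed.

Let tensor_addN : left_inverse tensor_zero tensor_opp tensor_add.
Proof.
elim/tensorW=> s; rewrite tensor_oppE; elim: s => [|[a w] s IHs].
  by rewrite tensor_addE.
have addACA x y z t : tensor_add (tensor_add x y) (tensor_add z t) =
    tensor_add (tensor_add x z) (tensor_add y t).
  rewrite -!tensor_addA; congr (tensor_add x _).
  by rewrite !tensor_addA; congr (tensor_add _ t); rewrite tensor_addC.
rewrite /= -[_ :: map _ _]cat1s -[_ :: s]cat1s -!tensor_addE addACA IHs.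
rewrite tensor_addC tensor_add0 tensor_addE.
apply/tensorP; apply: TensorTrans (TensorZero w).
rewrite -(addNr a); exact/TensorSym/TensorAddl.
Qed.

HB.instance Definition _ := GRing.isZmodule.Build tensor
  tensor_addA tensor_addC tensor_add0 tensor_addN.

Let tensor_scaleA a b (x : tensor) :
  tensor_scale a (tensor_scale b x) = tensor_scale (a * b) x.
Proof.
elim/tensorW: x => s; rewrite !tensor_scaleE -map_comp; congr (formal_sum _).
by apply: eq_map => p /=; rewrite mulrA.
Qed.

Let tensor_scale1 : left_id 1 tensor_scale.
Proof.
elim/tensorW=> s; rewrite tensor_scaleE -[in RHS](map_id s); congr (formal_sum _).
by apply: eq_map => -[a w] /=; rewrite mul1r.
Qed.

Let tensor_scaleDr : right_distributive tensor_scale +%R.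
Proof.
move=> a; elim/tensorW=> s; elim/tensorW=> t.
by rewrite [in LHS]/+%R /= tensor_addE !tensor_scaleE map_cat -tensor_addE.
Qed.

Let tensor_scaleDl (x : tensor) : {morph tensor_scale^~ x : a b / a + b}.
Proof.
move=> a b; elim/tensorW: x; elim=> [|[c w] s IHs].
  by rewrite !tensor_scaleE /= addr0.
have piD s1 s2 : formal_sum (s1 ++ s2) = formal_sum s1 + formal_sum s2.
  by rewrite -tensor_addE.
rewrite -/([:: (c, w)] ++ s) piD !tensor_scaleDr IHs addrACA; congr (_ + _).
rewrite !tensor_scaleE -piD /=; apply/tensorP; rewrite mulrDl; exact: TensorAddl.
Qed.

HB.instance Definition _ := GRing.Zmodule_isLmodule.Build L tensor
  tensor_scaleA tensor_scale1 tensor_scaleDr tensor_scaleDl.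

Definition tens (a : L) (w : W) : tensor := formal_sum [:: (a, w)].

Lemma scale_tens a b w : a *: tens b w = tens (a * b) w.
Proof. exact: tensor_scaleE. Qed.

Lemma tensDl a b w : tens (a + b) w = tens a w + tens b w.
Proof. by rewrite [RHS]tensor_addE; apply/tensorP/TensorAddl. Qed.

Lemma tensDr a v w : tens a (v + w) = tens a v + tens a w.
Proof. by rewrite [RHS]tensor_addE; apply/tensorP/TensorAddr. Qed.

Lemma tensZ (c : K) a w : tens (c *: a) w = tens a (c *: w).
Proof. exact/tensorP/TensorScale. Qed.

Lemma tensor_sum (x : tensor) : exists s : seq (L * W), x = \sum_(p <- s) tens p.1 p.2.
Proof.
elim/tensorW: x => s; exists s; elim: s => [|[a w] s IHs]; first by rewrite big_nil.
by rewrite big_cons -IHs [RHS]tensor_addE.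
Qed.

(* Universal property: with tensor_sum, lifts of bilinear maps exist and are
   unique. *)
Lemma tensor_lift (V : zmodType) (f : L -> W -> V) :
    (forall a b w, f (a + b) w = f a w + f b w) ->
    (forall a v w, f a (v + w) = f a v + f a w) ->
    (forall (c : K) a w, f (c *: a) w = f a (c *: w)) ->
  exists F : tensor -> V,
    (forall x y, F (x + y) = F x + F y) /\ (forall a w, F (tens a w) = f a w).
Proof.
move=> fDl fDr fZ; pose F s := \sum_(p <- s) f p.1 p.2.
have FE s t : tensor_eq s t -> F s = F t.
  elim=> {s t} [|s t _ ->|s t u _ -> _|s s' t t' _ h _ k|s t|w|a b w|a v w|c a w] //;
    rewrite /F ?big_cat ?big_cons ?big_nil /= ?addr0 //.
  - by rewrite -!/(F _) h k.
  - by rewrite addrC.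
  - by have /eqP := fDl 0 0 w; rewrite addr0 -subr_eq0 opprD addrA subrr sub0r oppr_eq0 => /eqP.
exists (fun x => F (repr x)); split=> [|a w].
  elim/tensorW=> s; elim/tensorW=> t; rewrite [formal_sum s + _]tensor_addE.
  by rewrite !(FE _ _ (tensor_reprK _)) /F big_cat.
by rewrite (FE _ _ (tensor_reprK _)) /F big_seq1.
Qed.

End Tensor.

Section Subspaces.
Variables (L : fieldType) (V : lmodType L).

Section Subspace.
Variable U : submodClosed V.

Record subspace : predArgType := Subspace { subval : V; subvalP : subval \in U }.

HB.instance Definition _ := [isSub for subval].
HB.instance Definition _ := [Choice of subspace by <:].
HB.instance Definition _ := [SubChoice_isSubLmodule of subspace by <:].

End Subspace.

(* Set-theoretically equal subspaces have distinct carrier types; recast is the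
   identity between them. *)
Definition recast (U U' : submodClosed V) (e : U =i U') (x : subspace U) : subspace U' :=
  Subspace (etrans (esym (e (subval x))) (subvalP x)).

End Subspaces.

Section GaloisAction.
Variables (K : fieldType) (L : splittingFieldType K) (W : lmodType K).
Implicit Types (s t : gal_of {:L}) (U V : submodClosed (tensor L W)).

Definition tensor_gal s : tensor L W -> tensor L W := tensor_map s.

Lemma tensor_gal_pi s x : tensor_gal s (@formal_sum K L W x) =
  @formal_sum K L W [seq (s p.1, p.2) | p <- x].
Proof. by apply: tensor_mapE => c a b; rewrite linearP. Qed.

Lemma tensor_gal_tens s a w : tensor_gal s (tens a w) = tens (s a) w.
Proof. exact: tensor_gal_pi. Qed.

Lemma tensor_galD s x y : tensor_gal s (x + y) = tensor_gal s x + tensor_gal s y.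
Proof.
elim/tensorW: x => x; elim/tensorW: y => y.
by rewrite [in LHS]/+%R /= tensor_addE !tensor_gal_pi map_cat -tensor_addE.
Qed.

Lemma tensor_galZ s a x : tensor_gal s (a *: x) = s a *: tensor_gal s x.
Proof.
have [r ->] := tensor_sum x; elim: r => [|[b w] r IHr].
  rewrite big_nil scaler0.
  have -> : tensor_gal s 0 = 0 by exact: (tensor_gal_pi s [::]).
  by rewrite scaler0.
rewrite big_cons /= scalerDr !tensor_galD scalerDr IHr; congr (_ + _).
by rewrite scale_tens !tensor_gal_tens scale_tens rmorphM.
Qed.

Lemma tensor_galM s t x : tensor_gal (s * t)%g x = tensor_gal t (tensor_gal s x).
Proof.
elim/tensorW: x => x; rewrite !tensor_gal_pi -map_comp; congr (formal_sum _).
by apply: eq_map => p /=; rewrite galM ?memvf.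
Qed.

Lemma tensor_gal1 x : tensor_gal 1%g x = x.
Proof.
elim/tensorW: x => x; rewrite tensor_gal_pi -[in RHS](map_id x).
by congr (formal_sum _); apply: eq_map => -[a w] /=; rewrite gal_id.
Qed.

Lemma tensor_galK s : cancel (tensor_gal s) (tensor_gal s^-1%g).
Proof. by move=> x; rewrite -tensor_galM mulgV tensor_gal1. Qed.

Lemma tensor_galVK s : cancel (tensor_gal s^-1%g) (tensor_gal s).
Proof. by move=> x; rewrite -tensor_galM mulVg tensor_gal1. Qed.

Definition twist s U : {pred tensor L W} :=
  fun x => `[< exists2 y, y \in U & x = tensor_gal s y >].

Lemma twistP s U x : reflect (exists2 y, y \in U & x = tensor_gal s y) (x \in twist s U).
Proof. exact: asboolP. Qed.

Lemma twist_submod_closed s U : submod_closed (twist s U).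
Proof.
split=> [|a x y /twistP[x' Ux ->] /twistP[y' Uy ->]]; apply/twistP.
  by exists 0; rewrite ?rpred0 //; symmetry; exact: (tensor_gal_pi s [::]).
exists (s^-1%g a *: x' + y'); first by rewrite rpredD ?rpredZ.
rewrite tensor_galD tensor_galZ; congr (_ *: _ + _).
by rewrite -galM ?memvf // mulVg gal_id.
Qed.

HB.instance Definition _ s U :=
  GRing.isSubmodClosed.Build L (tensor L W) (twist s U) (twist_submod_closed s U).

Lemma mem_twist s U x : x \in U -> tensor_gal s x \in twist s U.
Proof. by move=> Ux; apply/twistP; exists x. Qed.

Lemma mem_untwist s U x : x \in twist s U -> tensor_gal s^-1%g x \in U.
Proof. by case/twistP=> y Uy ->; rewrite tensor_galK. Qed.

Definition to_twist s U (x : subspace U) : subspace (twist s U) :=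
  Subspace (mem_twist s (subvalP x)).

Definition of_twist s U (x : subspace (twist s U)) : subspace U :=
  Subspace (mem_untwist (subvalP x)).

Definition twist_map s U V (phi : subspace U -> subspace V) :
    subspace (twist s U) -> subspace (twist s V) :=
  fun x => to_twist s (phi (of_twist x)).

Lemma twistK s U : (s * s = 1)%g -> twist s (twist s U) =i U.
Proof.
move=> ss1 x; have sK y : tensor_gal s (tensor_gal s y) = y.
  by rewrite -tensor_galM ss1 tensor_gal1.
apply/twistP/idP => [[y /twistP[z Uz ->] ->]|Ux]; first by rewrite sK.
by exists (tensor_gal s x); rewrite ?sK // mem_twist.
Qed.

Section Quadratic.
Variables (tau : gal_of {:L}) (tau2 : (tau * tau = 1)%g).

(* For psi : V -> U^tau, the map psi^tau : V^tau -> U^(tau tau) = U. *)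
Definition twist_back U V (psi : subspace V -> subspace (twist tau U)) :
    subspace (twist tau V) -> subspace U :=
  recast (twistK U tau2) \o twist_map psi.

(* (phi + (psi^tau)^-1) / 2, where 'pinv_ is the inverse of a bijection. *)
Definition tilde U V (phi : subspace U -> subspace (twist tau V))
    (psi : subspace V -> subspace (twist tau U)) :
    subspace U -> subspace (twist tau V) :=
  fun x => (2^-1 : L) *: (phi x + 'pinv_(fun=> 0) setT (twist_back psi) x).

(* When U = V^tau: phi \o psi^tau = psi^tau \o phi. *)
Definition twist_commute U V (e : U =i twist tau V)
    (phi : subspace U -> subspace (twist tau V))
    (psi : subspace V -> subspace (twist tau U)) : Prop :=
  forall x : subspace U,
    phi (twist_back psi (recast e x)) = recast e (twist_back psi (phi x)).

End Quadratic.

End GaloisAction.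

Lemma quadratic_gal_sqr (K : fieldType) (L : splittingFieldType K) :
  \dim {:L} = 2%N -> galois 1 {:L} ->
  forall tau : gal_of {:L}, tau \in 'Gal({:L} / 1)%g -> (tau * tau = 1)%g.
Proof.
move=> dimL galL tau tauG; have := galois_dim galL.
rewrite dimv1 divn1 dimL => cardG.
by have := order_dvdG tauG; rewrite -cardG order_dvdn expgS expg1 => /eqP.
Qed.

Definition nilpotent_endo (L : fieldType) (V : lmodType L) (n : V -> V) : Prop :=
  exists k, forall x, iter k n x = 0.

Definition nilpotent_of_exponent (L : fieldType) (V : lmodType L)
    (n : V -> V) (e : nat) : Prop :=
  [/\ (0 < e)%N, exists x, iter e.-1 n x != 0 & forall x, iter e n x = 0].

(* Main.v *)
Require Import Defs.
From HB Require Import structures.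
From mathcomp Require Import all_boot all_order all_fingroup all_algebra all_solvable all_field.
From mathcomp Require Import boolp classical_sets functions.
Import GRing.Theory.
Local Open Scope ring_scope.

(** Put [A = phi_+] and let [B] be the map [phi_-^tau] going back, so that
    [B A = 1 + n =: u]. The two averages are [A~ = (A + B^-1)/2] and
    [B~ = (B + A^-1)/2]; the point to check on the Galois side is that [B~] is
    indeed [phi~_-^tau] ([twist_back_tilde]), which holds because [tau] is an
    involution fixing 1/2. From there on everything is linear algebra over [L]
    for two spaces and a pair of isomorphisms in opposite directions.

    Expanding the product of the averages gives
      [B~ A~ = (u + 2 + u^-1)/4 = 1 + u^-1 (u - 1)^2 / 4 = 1 + u^-1 n^2 / 4],
    and since [n] commutes with [u^-1], the power [k] of [u^-1 n^2 / 4] is a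
    multiple of [n^(2k)], hence vanishes as soon as [2k >= e]
    ([half_sum_comp_unipotent], [defect_nilpotent]). The averages are bijective
    because [A~ = B^-1 (1 + n/2)] and [B~ = (1 + n/2) A^-1], where [1 + n/2] is
    unipotent ([half_sum_bij]).

    For the addendum, let [J] be the identification of the two equal spaces.
    The commutation relation says that [J] intertwines [B A] with [A B], hence
    also their inverses, hence the averaged products ([half_sum_intertwined]).
    If moreover [A = J (1 + m)] and [B J = 1 + p], then [m] and [p] commute, and
    [A~ = J (1 + (m - (1 + p)^-1 p)/2)], where the correction is a sum of two
    commuting nilpotents ([half_sum_unipotent]). *)

(** * Nilpotent endomorphisms *)

Section Nilpotent.
Set Implicit Arguments.
Unset Strict Implicit.

Lemma iter_commute (T U : Type) (f : T -> T) (f' : U -> U) (h : T -> U) k :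
  (forall x, h (f x) = f' (h x)) -> forall x, h (iter k f x) = iter k f' (h x).
Proof. by move=> hf x; elim: k => //= k <-. Qed.

Variables (F : fieldType) (V : lmodType F).
Implicit Types f g n : {linear V -> V}.

Lemma iter_comp_eq0 f (g : V -> V) k :
  (forall x, f (g x) = g (f x)) -> (forall x, iter k g x = 0) ->
  forall x, iter k (f \o g) x = 0.
Proof.
move=> fg gk x; suff -> : iter k (f \o g) x = iter k f (iter k g x).
  by rewrite gk iter_fix ?linear0.
by elim: k {gk} => //= k ->; rewrite (iter_commute k (fun y => esym (fg y))).
Qed.

(** The vanishing hypotheses concern a single vector, which lets the induction
    use them at [f x], killed one step earlier by [f], and at [g x]. *)
Lemma iter_add_eq0 f g : (forall x, f (g x) = g (f x)) ->
  forall a b x, iter a f x = 0 -> iter b g x = 0 -> iter (a + b) (f \+ g) x = 0.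
Proof.
move=> fg; have s0 k : iter k (f \+ g) 0 = 0 by rewrite iter_fix //= !linear0 addr0.
have sD k y z : iter k (f \+ g) (y + z) = iter k (f \+ g) y + iter k (f \+ g) z.
  by elim: k => //= k ->; rewrite !linearD addrACA.
elim=> [b x x0 _|a IHa]; first by rewrite [x]x0 s0.
elim=> [x _ x0|b IHb x fx gx]; first by rewrite [x]x0 s0.
rewrite addnS iterSr [(f \+ g) x]/= sD [X in _ + X]IHb -?iterSr //; last first.
  by rewrite -(iter_commute _ (fun y => esym (fg y))) fx linear0.
rewrite addr0 addSnnS IHa -?iterSr //.
by rewrite -(iter_commute _ fg) gx linear0.
Qed.

Lemma nilpotent_add f g : (forall x, f (g x) = g (f x)) ->
  nilpotent_endo f -> nilpotent_endo g -> nilpotent_endo (f \+ g).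
Proof. by move=> fg [a fa] [b gb]; exists (a + b)%N => x; exact: iter_add_eq0. Qed.

Lemma nilpotent_scale c f : nilpotent_endo f -> nilpotent_endo (c \*: f).
Proof.
case=> k fk; exists k; apply: (@iter_comp_eq0 (c \*: idfun)) => // x /=.
by rewrite linearZ.
Qed.

(** Instead of summing the geometric series, a preimage of [x] is built by
    induction on the power of [n] killing [x]: if [y] is a preimage of [n x],
    then [x - y] is a preimage of [x]. *)
Lemma bijective_id_add n : nilpotent_endo n -> bijective (fun x => x + n x).
Proof.
move=> [e ne]; suff [inj surj] : injective (fun x => x + n x) /\
    forall x, exists y, y + n y = x.
  have [g gK] := choice surj; exists g => // x; exact/inj/gK.
split.
- move=> x y /eqP; rewrite -subr_eq0 opprD addrACA -linearB => /eqP xy0.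
  apply/eqP; rewrite -subr_eq0; move: (x - y) xy0 (ne (x - y)) => {x y} z zn.
  have nz : n z = - z by apply/eqP; rewrite -addr_eq0 addrC zn.
  elim: e {ne} => [/= -> |e IHe] //; rewrite iterSr nz.
  rewrite -(iter_commute e (fun y => esym (linearN n y))) => /eqP.
  by rewrite oppr_eq0 => /eqP.
- move=> x; elim: e {ne} x (ne x) => [x /= ->|e IHe x].
    by exists 0; rewrite linear0 addr0.
  rewrite iterSr => /IHe [y yE]; exists (x - y).
  by rewrite linearB -yE addrACA -opprD addrK.
Qed.

(** On the zero space no map has an exponent, since the power 0 already
    vanishes; hence the nonzero vector [x0]. *)
Lemma nilpotent_exponent_le n k (x0 : V) : x0 != 0 -> (forall x, iter k n x = 0) ->
  exists2 e, nilpotent_of_exponent n e & (e <= k)%N.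
Proof.
move=> x0_neq0 nk; pose P j := `[< forall x, iter j n x = 0 >].
have exP : exists j, P j by exists k; exact/asboolP.
case: (ex_minnP exP) => e /asboolP ne e_min; exists e; last exact/e_min/asboolP.
have e_gt0 : (0 < e)%N.
  by case: e {e_min} ne => // /(_ x0) /= x00; rewrite x00 eqxx in x0_neq0.
split=> //; apply: contrapT => /forallNP ne1.
suff /e_min : `[< forall x, iter e.-1 n x = 0 >] by rewrite leqNgt prednK // leqnn.
by apply/asboolP => x; apply: contrapT => /eqP; exact: ne1.
Qed.

End Nilpotent.

(** * Averaging an isomorphism with the inverse of another *)

Section HalfSum.
Set Implicit Arguments.
Unset Strict Implicit.
Variables (F : fieldType) (two_neq0 : 2 != 0 :> F).

Definition half_sum (X Y : lmodType F) (f g : X -> Y) : X -> Y :=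
  2^-1 \*: (f \+ g).

HB.instance Definition _ (X Y : lmodType F) (f g : {linear X -> Y}) :=
  GRing.Linear.copy (half_sum f g) (2^-1 \*: (f \+ g)).

Lemma half_double (X : lmodType F) (x : X) : 2^-1 *: (x + x) = x.
Proof. by rewrite -mulr2n -scaler_nat scalerA mulVf ?scale1r. Qed.

Lemma linear_inverse (X Y : lmodType F) (f : {linear X -> Y}) : bijective f ->
  exists g : {linear Y -> X}, cancel f g /\ cancel g f.
Proof.
case=> g fK gK; pose gl := GRing.isLinear.Build F Y X *:%R g (can2_linear fK gK).
by pose g' : {linear Y -> X} := HB.pack g gl; exists g'.
Qed.

Section Inverses.
Variables (X Y : lmodType F).
Variables (f : {linear X -> Y}) (f' : {linear Y -> X}).
Variables (g : {linear Y -> X}) (g' : {linear X -> Y}).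
Hypotheses (fK : cancel f f') (g'K : cancel g' g).

(** The cross terms of the product are identities. *)
Lemma half_sum_comp x : half_sum g f' (half_sum f g' x) =
  2^-1 *: (2^-1 *: (g (f x) + x + (x + f' (g' x)))).
Proof.
by rewrite /half_sum /= !linearZ !linearD /= g'K fK !scalerDr.
Qed.

End Inverses.

Section Unipotent.
Variables (X Y : lmodType F).
Variables (f : {linear X -> Y}) (f' : {linear Y -> X}).
Variables (g : {linear Y -> X}) (g' : {linear X -> Y}).
Hypotheses (fK : cancel f f') (f'K : cancel f' f).
Hypotheses (gK : cancel g g') (g'K : cancel g' g).

Variables (n : {linear X -> X}) (gf : forall x, g (f x) = x + n x).

(** With [u = g f = 1 + n], this is [u^-1 n^2 / 4], the deviation from the
    identity of the product of the two averages. *)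
Definition defect : X -> X := (2^-1 \*: (2^-1 \*: (f' \o g'))) \o (n \o n).

HB.instance Definition _ :=
  GRing.Linear.copy defect ((2^-1 \*: (2^-1 \*: (f' \o g'))) \o (n \o n)).

(** From [u^-1 (1 + n) = 1], and below from [(1 + n) u^-1 = 1]: together they
    say that [n] commutes with [u^-1 = f' g']. *)
Lemma unipotent_inv_nil x : f' (g' (n x)) = x - f' (g' x).
Proof.
by rewrite -[x in x - _]fK -[f x in x in x - _]gK gf !linearD addrC addKr.
Qed.

Lemma nil_unipotent_inv x : n (f' (g' x)) = x - f' (g' x).
Proof. by apply/eqP; rewrite eq_sym subr_eq addrC -gf f'K g'K. Qed.

Lemma half_sum_comp_unipotent x : half_sum g f' (half_sum f g' x) = x + defect x.
Proof.
rewrite half_sum_comp // gf /defect /= !unipotent_inv_nil opprB.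
have quarter : x = 2^-1 *: (2^-1 *: (x + x + (x + x))) by rewrite !half_double.
rewrite [X in _ = X + _]quarter -!scalerDr; congr (_ *: (_ *: _)).
by rewrite [RHS]addrACA -[x + x + (_ - x)]addrA subrKC [x + x + n x]addrAC.
Qed.

Lemma defect_nilpotent e : (forall x, iter e n x = 0) ->
  forall x, iter (uphalf e) defect x = 0.
Proof.
move=> ne.
apply: (@iter_comp_eq0 _ _ (2^-1 \*: (2^-1 \*: (f' \o g'))) (n \o n)) => x /=.
  have comm y : f' (g' (n y)) = n (f' (g' y)).
    by rewrite unipotent_inv_nil nil_unipotent_inv.
  by rewrite !comm !linearZ.
have -> : iter (uphalf e) (n \o n) x = iter (uphalf e * 2) n x by rewrite iterM.
have : (e <= uphalf e * 2)%N by rewrite muln2 -leq_uphalf_double.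
by move/subnK <-; rewrite iterD ne iter_fix ?linear0.
Qed.

(** The averages factor as [g' (1 + n/2)] and [(1 + n/2) f']. *)
Lemma half_sum_bij : nilpotent_endo n ->
  bijective (half_sum f g') /\ bijective (half_sum g f').
Proof.
move=> /(nilpotent_scale 2^-1) n_nil.
have id_n_bij := bijective_id_add (n := 2^-1 \*: n) n_nil.
split.
- apply: (eq_bij (bij_comp _ id_n_bij)) => [|x]; first by exists g.
  rewrite /half_sum /= -{1}[x]half_double -scalerDr linearZ.
  by rewrite -addrA -gf linearD /= gK addrC.
- apply: (eq_bij (bij_comp id_n_bij _)) => [|y]; first by exists f.
  rewrite /half_sum /= -{1}[f' y]half_double -scalerDr.
  by rewrite -addrA -gf f'K addrC.
Qed.

End Unipotent.

Section Intertwined.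
Variables (X Y : lmodType F).
Variables (f : {linear X -> Y}) (f' : {linear Y -> X}).
Variables (g : {linear Y -> X}) (g' : {linear X -> Y}).
Hypotheses (fK : cancel f f') (f'K : cancel f' f).
Hypotheses (gK : cancel g g') (g'K : cancel g' g).
Variables (J : {linear X -> Y}) (J' : {linear Y -> X}).
Hypotheses (JK : cancel J J') (J'K : cancel J' J).
Hypothesis fgJ : forall x, f (g (J x)) = J (g (f x)).

(** [J] intertwines [g f] with [f g] by hypothesis, hence also their inverses,
    and [half_sum_comp] expresses both averaged products through these. *)
Lemma half_sum_intertwined x :
  half_sum f g' (half_sum g f' (J x)) = J (half_sum g f' (half_sum f g' x)).
Proof.
have inv_fgJ : g' (f' (J x)) = J (f' (g' x)).
  by rewrite -{1}[x]g'K -{1}(f'K (g' x)) -fgJ fK gK.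
by rewrite !half_sum_comp // fgJ inv_fgJ !linearZ /= !linearD.
Qed.

Variables (m p : {linear X -> X}).
Hypotheses (fE : forall x, f x = J (x + m x)) (gJE : forall x, g (J x) = x + p x).

(** [m'] is [(m - (1 + p)^-1 p) / 2]. Cancelling [J], the relation [fgJ] says that
    [1 + m] and [1 + p] commute, so that [m], [p] and [(1 + p)^-1] all commute. *)
Lemma half_sum_unipotent : nilpotent_endo m -> nilpotent_endo p ->
  exists m' : {linear X -> X},
    nilpotent_endo m' /\ forall x, half_sum f g' x = J (x + m' x).
Proof.
move=> m_nil p_nil.
(* [b'] is the inverse of [g J = 1 + p]. *)
pose b' : {linear X -> X} := J' \o g'.
have b'K x : b' (g (J x)) = x by rewrite /b' /= gK JK.
have Kb' x : g (J (b' x)) = x by rewrite /b' /= J'K g'K.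
have Jb' x : J (b' x) = g' x by rewrite /b' /= J'K.
clearbody b'.
have mp x : m (p x) = p (m x).
  have := fgJ x; rewrite !fE gJE => /(can_inj JK).
  by rewrite gJE !linearD addrACA => /addrI /addrI.
have bp x : b' (p x) = p (b' x).
  by apply: (addrI (b' x)); rewrite -gJE Kb' -linearD -gJE b'K.
have bm x : b' (m x) = m (b' x).
  by rewrite -{1}[x]Kb' gJE linearD mp -gJE b'K.
exists (2^-1 \*: (m \+ ((-1 \*: b') \o p))); split.
  apply/nilpotent_scale/nilpotent_add => //= [x|].
    by rewrite linearZ -bm mp.
  case: p_nil => k pk; exists k; apply: (@iter_comp_eq0 _ _ (-1 \*: b')) => // x /=.
  by rewrite linearZ /= bp.
move=> x; rewrite /half_sum /= fE -Jb' -linearD -linearZ scaleN1r.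
have b'E : b' x = x - b' (p x) by rewrite bp -[X in X - _]Kb' gJE addrK.
congr (J _); rewrite -[X in _ = X + _]half_double -scalerDr; congr (_ *: _).
by rewrite b'E addrACA.
Qed.

End Intertwined.

End HalfSum.

(** * Twisting by an involution *)

Section Twists.
Set Implicit Arguments.
Unset Strict Implicit.
Variables (K : fieldType) (L : splittingFieldType K) (W : lmodType K).
Implicit Types (U V : submodClosed (tensor L W)).

Lemma recast_linear U V (e : U =i V) : linear (recast e).
Proof. by move=> a x y; apply: val_inj. Qed.

HB.instance Definition _ U V (e : U =i V) :=
  GRing.isLinear.Build L (subspace U) (subspace V) *:%R (recast e) (recast_linear e).

Lemma recastK U V (e : U =i V) (e' : V =i U) : cancel (recast e) (recast e').
Proof. by move=> x; apply: val_inj. Qed.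

(** The two semi-linear conjugating maps cancel each other's twist of the
    scalars. *)
Lemma twist_map_linear s U V (phi : {linear subspace U -> subspace V}) :
  linear (twist_map (s := s) phi).
Proof.
move=> a x y; apply: val_inj => /=.
have -> : of_twist (a *: x + y) = s^-1%g a *: of_twist x + of_twist y.
  by apply: val_inj => /=; rewrite tensor_galD tensor_galZ.
rewrite linearP /= tensor_galD tensor_galZ; congr (_ *: _ + _).
by rewrite -galM ?memvf // mulVg gal_id.
Qed.

HB.instance Definition _ s U V (phi : {linear subspace U -> subspace V}) :=
  GRing.isLinear.Build L _ _ *:%R (twist_map (s := s) phi) (@twist_map_linear s U V phi).

Lemma to_twistK s U : cancel (@to_twist K L W s U) (@of_twist K L W s U).
Proof. by move=> x; apply: val_inj; exact: tensor_galK. Qed.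

Lemma of_twistK s U : cancel (@of_twist K L W s U) (@to_twist K L W s U).
Proof. by move=> x; apply: val_inj; exact: tensor_galVK. Qed.

Lemma pinv_unique (X Y : Type) (d : Y -> X) (f : X -> Y) (g : Y -> X) :
  cancel f g -> cancel g f -> 'pinv_d setT f = g.
Proof.
move=> fK gK; apply/funext => y; rewrite -{1}[y]gK pinvKV ?inE //.
by move=> ? ? _ _; exact: (can_inj fK).
Qed.

Section Involution.
Variables (tau : gal_of {:L}) (tau2 : (tau * tau = 1)%g).

HB.instance Definition _ U V (psi : {linear subspace V -> subspace (twist tau U)}) :=
  GRing.Linear.copy (twist_back tau2 psi) (recast (twistK U tau2) \o twist_map psi).

(** [psi] is recovered from [twist_back tau2 psi] by undoing the bijections
    that it is composed with. *)
Lemma twist_back_bij U V (psi : subspace V -> subspace (twist tau U)) :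
  bijective (twist_back tau2 psi) <-> bijective psi.
Proof.
have rK := recastK (twistK U tau2) (fun x => esym (twistK U tau2 x)).
have Kr := recastK (fun x => esym (twistK U tau2 x)) (twistK U tau2).
split=> [bij|[g psiK gK]].
  have of_bij U' : bijective (@of_twist K L W tau U').
    by exists (@to_twist K L W tau U'); [exact: of_twistK | exact: to_twistK].
  have to_bij U' : bijective (@to_twist K L W tau U').
    by exists (@of_twist K L W tau U'); [exact: to_twistK | exact: of_twistK].
  apply: (eq_bij (f := @of_twist K L W tau _ \o
      recast (fun x => esym (twistK U tau2 x)) \o
      twist_back tau2 psi \o @to_twist K L W tau _)).
    apply: bij_comp (to_bij _); apply: bij_comp bij; apply: bij_comp (of_bij _) _.
    by exists (recast (twistK U tau2)).
  by move=> x; rewrite /twist_back /= rK /twist_map to_twistK to_twistK.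
exists (twist_map g \o recast (fun x => esym (twistK U tau2 x))) => x;
  rewrite /twist_back /twist_map /=.
  by rewrite rK to_twistK psiK of_twistK.
by rewrite to_twistK gK of_twistK Kr.
Qed.

Lemma tildeE U V (phi : subspace U -> subspace (twist tau V))
    (psi : subspace V -> subspace (twist tau U)) psi' :
  cancel (twist_back tau2 psi) psi' -> cancel psi' (twist_back tau2 psi) ->
  tilde tau2 phi psi = half_sum phi psi'.
Proof. by move=> psiK psi'K; rewrite /tilde (pinv_unique _ psiK psi'K). Qed.

(** Twisting commutes with averaging: [tau] fixes 1/2, and twisting back
    [(twist_back tau2 phi)^-1] gives [phi^-1] since [tau] is an involution. *)
Lemma twist_back_tilde U V (phi : subspace U -> subspace (twist tau V))
    (psi : subspace V -> subspace (twist tau U)) phi' :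
  cancel phi phi' -> cancel phi' phi ->
  twist_back tau2 (tilde tau2 psi phi) = half_sum (twist_back tau2 psi) phi'.
Proof.
move=> phiK phi'K; apply/funext => y; apply: val_inj => /=.
rewrite tensor_galZ tensor_galD fmorphV rmorph_nat; congr (_ *: (_ + _)).
have bij : bijective (twist_back tau2 phi) by apply/twist_back_bij; exists phi'.
have tau_inv : tau^-1%g = tau by apply/eqP; rewrite eq_invg_mul tau2.
have yE : of_twist y = twist_back tau2 phi (to_twist tau (phi' y)).
  by apply: val_inj; rewrite /= to_twistK phi'K tau_inv.
rewrite yE; case: (bij) => g gK Kg; rewrite (pinv_unique _ gK Kg) gK /=.
by rewrite -tensor_galM tau2 tensor_gal1.
Qed.

Section Transport.
Variables (U V : submodClosed (tensor L W)) (eU : U =i twist tau V).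
Variable m : {linear subspace V -> subspace V}.

(** When [U = V^tau], this is [m^tau] seen as an endomorphism of [U]. *)
Definition transport : subspace U -> subspace U :=
  recast (fun x => esym (eU x)) \o twist_map m \o recast eU.

HB.instance Definition _ := GRing.Linear.copy transport
  (recast (fun x => esym (eU x)) \o twist_map m \o recast eU).

(** [h], which is [tau^-1] on vectors, is injective and conjugates [transport]
    into [m]. *)
Lemma nilpotent_transport : nilpotent_endo m -> nilpotent_endo transport.
Proof.
case=> k mk; exists k => x; pose h (y : subspace U) := of_twist (recast eU y).
have hm y : h (transport y) = m (h y).
  by rewrite /h /transport /= recastK to_twistK.
have h_inj : injective h.
  move=> y z /(can_inj (@of_twistK tau V)).
  exact: (can_inj (recastK eU (fun x => esym (eU x)))).
apply: h_inj; rewrite (iter_commute k hm) mk; apply: val_inj => /=.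
by symmetry; exact: (tensor_gal_pi _ [::]).
Qed.

Lemma twist_back_unipotent (eV : V =i twist tau U)
    (psi : subspace V -> subspace (twist tau U)) :
  (forall y, psi y = recast eV (y + m y)) ->
  forall x, twist_back tau2 psi (recast eU x) = x + transport x.
Proof.
move=> psiE x; apply: val_inj.
by rewrite /= psiE /= tensor_galD tensor_galVK.
Qed.

End Transport.

End Involution.
End Twists.

(** * Averaging isomorphisms between a subspace and a twisted one *)

Theorem proposition4p1 (K : fieldType) (L : splittingFieldType K)
    (charK : 2%N \notin [pchar K])
    (dimL : \dim {:L} = 2%N) (galL : galois 1 {:L})
    (tau : gal_of {:L}) (tauG : tau \in 'Gal({:L} / 1)%g) (tau_neq1 : tau != 1%g)
    (W : lmodType K) (Wp Wm : submodClosed (tensor L W))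
    (phip : {linear subspace Wp -> subspace (twist tau Wm)})
    (phim : {linear subspace Wm -> subspace (twist tau Wp)})
    (phip_bij : bijective phip) (phim_bij : bijective phim)
    (n : {linear subspace Wp -> subspace Wp}) (e : nat)
    (n_nilp : nilpotent_of_exponent n e)
    (phi_n : let tau2 := quadratic_gal_sqr dimL galL tauG in
       forall x, twist_back tau2 phim (phip x) = x + n x) :
  let tau2 := quadratic_gal_sqr dimL galL tauG in
  let tphip := tilde tau2 phip phim in
  let tphim := tilde tau2 phim phip in
  [/\ (linear tphip /\ bijective tphip),
      (linear tphim /\ bijective tphim),
      (exists (n' : {linear subspace Wp -> subspace Wp}) (e' : nat),
        [/\ forall x, twist_back tau2 tphim (tphip x) = x + n' x,
            nilpotent_of_exponent n' e'
          & (e' <= uphalf e)%N])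
    & forall (eqp : Wp =i twist tau Wm) (eqm : Wm =i twist tau Wp),
      twist_commute tau2 eqp phip phim ->
      twist_commute tau2 eqm phim phip ->
      (twist_commute tau2 eqp tphip tphim /\ twist_commute tau2 eqm tphim tphip)
      /\ (forall (mp : {linear subspace Wp -> subspace Wp})
                 (mm : {linear subspace Wm -> subspace Wm}),
          nilpotent_endo mp -> nilpotent_endo mm ->
          (forall x, phip x = recast eqp (x + mp x)) ->
          (forall x, phim x = recast eqm (x + mm x)) ->
          exists (mp' : {linear subspace Wp -> subspace Wp})
                 (mm' : {linear subspace Wm -> subspace Wm}),
            [/\ nilpotent_endo mp', nilpotent_endo mm',
                forall x, tphip x = recast eqp (x + mp' x)
              & forall x, tphim x = recast eqm (x + mm' x)])].
Proof.
move=> tau2 tphip tphim; rewrite -/tau2 in phi_n.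
have two_neq0 : 2 != 0 :> L.
  by rewrite -(rmorph_nat (in_alg L)) fmorph_eq0; move: charK; rewrite inE.
(* [A'] and [B'] are the linear inverses of the maps [phi_+^tau] and
   [phi_-^tau], which go back. *)
have [phip' [phipK phip'K]] := linear_inverse phip_bij.
have [phim' [phimK phim'K]] := linear_inverse phim_bij.
have [A' [AK A'K]] := linear_inverse ((twist_back_bij tau2 phip).2 phip_bij).
have [B' [BK B'K]] := linear_inverse ((twist_back_bij tau2 phim).2 phim_bij).
have tphipE : tphip = half_sum phip B' by exact: tildeE.
have tphimE : tphim = half_sum phim A' by exact: tildeE.
have backpE : twist_back tau2 tphip = half_sum (twist_back tau2 phip) phim'.
  exact: twist_back_tilde.
have backmE : twist_back tau2 tphim = half_sum (twist_back tau2 phim) phip'.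
  exact: twist_back_tilde.
have [e_gt0 [x0 nx0] ne] := n_nilp.
have [bijp bijm] : bijective (half_sum phip B') /\
    bijective (half_sum (twist_back tau2 phim) phip').
  by apply: (half_sum_bij two_neq0 _ _ _ _ phi_n) => //; exists e.
split.
- by rewrite tphipE; split=> // a x y; rewrite linearP.
- split; first by rewrite tphimE => a x y; rewrite linearP.
  by apply/(twist_back_bij tau2); rewrite backmE.
- have defect_e x : iter (uphalf e) (defect phip' B' n) x = 0.
    by apply: (defect_nilpotent _ _ _ _ phi_n).
  have [e' e'P e'_le] := nilpotent_exponent_le (n := defect phip' B' n) nx0 defect_e.
  exists (defect phip' B' n), e'; split=> // x.
  by rewrite backmE tphipE; apply: half_sum_comp_unipotent.
- move=> eqp eqm commp commm; split.
    split=> x; rewrite ?backmE ?backpE ?tphipE ?tphimE; exact: half_sum_intertwined.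
  move=> mp mm mp_nil mm_nil phipE phimE.
  have [mp' [mp'_nil mp'E]] := half_sum_unipotent two_neq0 BK B'K
    (recastK eqp (fun x => esym (eqp x))) (recastK (fun x => esym (eqp x)) eqp)
    commp phipE (twist_back_unipotent tau2 eqp phimE) mp_nil
    (nilpotent_transport eqp mm_nil).
  have [mm' [mm'_nil mm'E]] := half_sum_unipotent two_neq0 AK A'K
    (recastK eqm (fun x => esym (eqm x))) (recastK (fun x => esym (eqm x)) eqm)
    commm phimE (twist_back_unipotent tau2 eqm phipE) mm_nil
    (nilpotent_transport eqm mp_nil).
  by exists mp', mm'; split=> // x; rewrite ?tphipE ?tphimE.
Qed.
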